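(* Consider the problem $$\min_{x_1,\dots,x_n}\ \sum_{i=1}^n f_i(x_i)\quad\text{s.t.}\quad \sum_{i=1}^n \mathcal{A}_i(x_i)=b ,\qquad f_i=g_i+h_i ,$$ let $(x_1^*,\dots,x_n^*,\lambda^* )$ be a KKT point of it, and let $\{(x_1^k,\dots,x_n^k,\lambda^k)\}$ be generated by proximal LADMPSAP with a non-decreasing positive penalty sequence $\{\beta_k\}$ and $\tau_i^{(k)}=T_i+\beta_k\eta_i$, where $T_i\ge L_i$ and $\eta_i>n\|\mathcal{A}_i\|^2$ are positive constants, $i=1,\dots,n$. For $K\ge0$ define $\bar x_i^K=\sum_{k=0}^K\gamma_k x_i^{k+1}$, where $\gamma_k=\beta_k^{-1}\big/\sum_{j=0}^K\beta_j^{-1}$. Then $$\sum_{i=1}^n\Big(f_i(\bar x_i^K)-f_i(x_i^* )+\big\langle\mathcal{A}_i^\dagger(\lambda^* ),\bar x_i^K-x_i^*\big\rangle\Big)+\frac{\alpha\beta_0}{2}\Big\|\sum_{i=1}^n\mathcal{A}_i(\bar x_i^K)-b\Big\|^2\le\frac{C_0}{2\sum_{k=0}^K\beta_k^{-1}},$$ where $$\alpha^{-1}=(n+1)\max\Big(1,\Big\{\frac{\|\mathcal{A}_i\|^2}{\eta_i-n\|\mathcal{A}_i\|^2},\ i=1,\dots,n\Big\}\Big),\qquad C_0=\sum_{i=1}^n\beta_0^{-1}\tau_i^{(0)}\|x_i^0-x_i^*\|^2+\beta_0^{-2}\|\lambda^0-\lambda^*\|^2 .$$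
   Context: Data: $g_i,h_i$ are convex on $\mathbb{R}^{d_i}$; $g_i$ is finite and differentiable with $\|\nabla g_i(x)-\nabla g_i(y)\|\le L_i\|x-y\|$ for all $x,y\in\mathbb{R}^{d_i}$; $h_i$ may be non-differentiable; $f_i=g_i+h_i$ is closed proper convex. $\mathcal{A}_i:\mathbb{R}^{d_i}\to\mathbb{R}^m$ are linear mappings with adjoints $\mathcal{A}_i^\dagger$ and operator norms $\|\mathcal{A}_i\|$; $b\in\mathbb{R}^m$; $\|\cdot\|$ is the Euclidean (Frobenius) norm. Standing assumptions: no $\mathcal{A}_i$ is the zero mapping; the solution of $\sum_i\mathcal{A}_i(x_i)=b$ is non-unique; $(x_1,\dots,x_n)\mapsto\sum_i\mathcal{A}_i(x_i)$ is onto. KKT point: $(x_1^*,\dots,x_n^*,\lambda^* )$ with $\sum_i\mathcal{A}_i(x_i^* )=b$ and $-\mathcal{A}_i^\dagger(\lambda^* )\in\partial f_i(x_i^* )$ for all $i$. Proximal LADMPSAP, with penalty parameters $\beta_k>0$, run without stopping from an arbitrary initial point: given $(x_1^k,\dots,x_n^k,\lambda^k)$, set $$\hat\lambda^k=\lambda^k+\beta_k\Big(\sum_{i=1}^n\mathcal{A}_i(x_i^k)-b\Big),$$ $$x_i^{k+1}=\operatorname*{argmin}_{x_i}\ h_i(x_i)+\frac{\tau_i^{(k)}}{2}\Big\|x_i-x_i^k+\frac{1}{\tau_i^{(k)}}\big[\mathcal{A}_i^\dagger(\hat\lambda^k)+\nabla g_i(x_i^k)\big]\Big\|^2,\quad i=1,\dots,n,$$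 $$\lambda^{k+1}=\lambda^k+\beta_k\Big(\sum_{i=1}^n\mathcal{A}_i(x_i^{k+1})-b\Big).$$ *)

(* Defs.v *)
From HB Require Import structures.
From mathcomp Require Import all_boot all_order all_algebra.
From mathcomp Require Import all_classical all_reals all_analysis.

Set Implicit Arguments.
Unset Strict Implicit.
Unset Printing Implicit Defensive.

Import Order.TTheory GRing.Theory Num.Theory.
Import numFieldNormedType.Exports.

Local Open Scope classical_set_scope.
Local Open Scope ring_scope.

(* R^d is 'rV[R]_d. The library norm `|x| on matrices is the sup norm, so the
   Euclidean one is introduced separately; both induce the same topology, hence
   differentiability and lower semicontinuity are those of the library. *)
Section Euclidean.
Context {R : realType}.

Definition dot d (u v : 'rV[R]_d) : R := \sum_(j < d) u 0 j * v 0 j.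

Definition norm2 d (u : 'rV[R]_d) : R := Num.sqrt (dot u u).

Definition opnorm d m (A : {linear 'rV[R]_d -> 'rV[R]_m}) : R :=
  sup [set norm2 (A u) | u in [set u : 'rV[R]_d | norm2 u <= 1]].

Definition adjoint d m (A : {linear 'rV[R]_d -> 'rV[R]_m}) (y : 'rV[R]_m) :
  'rV[R]_d := y *m (lin1_mx A)^T.

Lemma dot_mulmx d (u v : 'rV[R]_d) : dot u v = (u *m v^T) 0 0.
Proof. by rewrite /dot mxE; apply: eq_bigr => j _; rewrite !mxE. Qed.

Lemma adjointP d m (A : {linear 'rV[R]_d -> 'rV[R]_m}) x y :
  dot (adjoint A y) x = dot y (A x).
Proof.
by rewrite !dot_mulmx /adjoint -(mul_rV_lin1 A) trmx_mul mulmxA.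
Qed.

Definition gradient d (g : 'rV[R]_d -> R^o) (x : 'rV[R]_d) : 'rV[R]_d :=
  \row_j 'D_(delta_mx 0 j) g x.

Lemma gradientP d (g : 'rV[R]_d -> R^o) x v :
  differentiable g x -> 'd g x v = dot (gradient g x) v.
Proof.
move=> dg; rewrite {1}(row_sum_delta v) linear_sum; apply: eq_bigr => j _.
by rewrite linearZ /= mxE deriveE// mulrC.
Qed.

End Euclidean.

(* Extended-real-valued convex analysis, with conventions as in Rockafellar:
   convexity is convexity of the epigraph, and for a proper function closedness
   is lower semicontinuity. *)
Section ConvexAnalysis.
Context {R : realType} {d : nat}.
Implicit Types (f : 'rV[R]_d -> \bar R) (x s : 'rV[R]_d).
Local Open Scope ereal_scope.

Definition epigraph f : set (convex_lmodType ('rV[R]_d * R^o)%type) :=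
  [set p | f p.1 <= p.2%:E].

Definition econvex f : Prop := convex_set (epigraph f).

Definition proper f : Prop :=
  (exists x, f x < +oo) /\ (forall x, -oo < f x).

Definition closed_proper_convex f : Prop :=
  [/\ lower_semicontinuous f, proper f & econvex f].

Definition subdifferential f x : set 'rV[R]_d :=
  [set s | forall y, f x + (dot s (y - x)%R)%:E <= f y].

Definition argmin f : set 'rV[R]_d := [set x | forall y, f x <= f y].

End ConvexAnalysis.

Section Problem.
Context {R : realType} {n m : nat} {d : 'I_n -> nat}.
Variables (g : forall i, 'rV[R]_(d i) -> R^o)
  (h : forall i, 'rV[R]_(d i) -> \bar R).
Variables (A : forall i, {linear 'rV[R]_(d i) -> 'rV[R]_m}) (b : 'rV[R]_m).

Definition objective i (x : 'rV[R]_(d i)) : \bar R := ((g x)%:E + h x)%E.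

Definition constraint_map (x : forall i, 'rV[R]_(d i)) : 'rV[R]_m :=
  \sum_(i < n) A i (x i).

Definition KKT_point (x : forall i, 'rV[R]_(d i)) (lam : 'rV[R]_m) : Prop :=
  constraint_map x = b /\
  forall i, subdifferential (@objective i) (x i) (- adjoint (A i) lam).

Definition prox_objective i (tau : R) (x : 'rV[R]_(d i)) (lamhat : 'rV[R]_m)
    (y : 'rV[R]_(d i)) : \bar R :=
  (h y + (tau / 2 *
    norm2 (y - x + tau^-1 *: (adjoint (A i) lamhat + gradient (@g i) x)) ^+ 2)%:E)%E.

Definition prox_LADMPSAP (beta : nat -> R) (tau : nat -> 'I_n -> R)
    (x : nat -> forall i, 'rV[R]_(d i)) (lam : nat -> 'rV[R]_m) : Prop :=
  forall k,
    let lamhat := lam k + beta k *: (constraint_map (x k) - b) in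
    (forall i, argmin (@prox_objective i (tau k i) (x k i) lamhat) (x k.+1 i)) /\
    lam k.+1 = lam k + beta k *: (constraint_map (x k.+1) - b).

End Problem.

Section Constants.
Context {R : realType} {n m : nat} {d : 'I_n -> nat}.

Definition ladm_tau (T eta : 'I_n -> R) (beta : nat -> R) (k : nat) (i : 'I_n) : R :=
  T i + beta k * eta i.

Definition gamma_weight (beta : nat -> R) (K k : nat) : R :=
  (beta k)^-1 / \sum_(j < K.+1) (beta j)^-1.

Definition ergodic_mean (beta : nat -> R) (x : nat -> forall i, 'rV[R]_(d i))
    (K : nat) (i : 'I_n) : 'rV[R]_(d i) :=
  \sum_(k < K.+1) gamma_weight beta K k *: x k.+1 i.

Definition alpha_const (A : forall i, {linear 'rV[R]_(d i) -> 'rV[R]_m})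
    (eta : 'I_n -> R) : R :=
  (n.+1%:R * \big[Num.max/1]_(i < n)
     (opnorm (A i) ^+ 2 / (eta i - n%:R * opnorm (A i) ^+ 2)))^-1.

Definition C0_const (beta0 : R) (tau0 : 'I_n -> R)
    (x0 xs : forall i, 'rV[R]_(d i)) (lam0 lams : 'rV[R]_m) : R :=
  \sum_(i < n) beta0^-1 * tau0 i * norm2 (x0 i - xs i) ^+ 2
  + beta0 ^- 2 * norm2 (lam0 - lams) ^+ 2.

End Constants.

(* Main.v *)
Require Import Defs.
From HB Require Import structures.
From mathcomp Require Import all_boot all_order all_algebra.
From mathcomp Require Import all_classical all_reals all_analysis.
From mathcomp Require Import ring lra.

Set Implicit Arguments.
Unset Strict Implicit.
Unset Printing Implicit Defensive.

Import Order.TTheory GRing.Theory Num.Theory.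
Import numFieldNormedType.Exports.

Local Open Scope classical_set_scope.
Local Open Scope ring_scope.

(** The proof follows a Lyapunov function and then averages.

    Fix one iteration, write [xp] for the new point, [r] and [rp] for the
    residuals of the constraint before and after it, and [u i] for the
    increment [xp i - x i] of a block. Minimality of [xp i] in the proximal
    problem gives a subgradient of [h i] at [xp i] ([prox_subgradient]).
    Convexity of [g i] and Lipschitz continuity of its gradient give an upper
    bound on [g i (xp i) - g i (xs i)] that is linear in the same gradient, up
    to [T i / 2 * norm2 (u i) ^+ 2] ([smooth_convex_three_point]). In the sum of
    the two ([prox_gradient_step_le]) the gradients cancel, and three kinds of
    terms remain: telescoping squared distances to [xs i], negative squares of
    the increments with the factor [tau i - T i = beta * eta i], and the inner
    product of [rp] with the error of the predicted multiplier.

    The latter splits into telescoping distances to [lams], the negative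
    square of [r] and the positive square of [rp - r]
    ([dot_multiplier_step]). Since [rp - r] is the sum of the [n] vectors
    [A i (u i)], its square is at most [n] times the sum of the
    [opnorm (A i) ^+ 2 * norm2 (u i) ^+ 2], which the condition on [eta i]
    makes smaller than the negative terms. What is left of the negative terms
    dominates [alpha * norm2 rp ^+ 2] ([alpha_residual_le]); this is where the
    formula for [alpha] comes from. After multiplication by [2 / beta] the
    Lyapunov function that telescopes is exactly [C0_const]
    ([lyapunov_decrease]), and its weights [T i / beta + eta i] and
    [beta ^- 2] do not increase along the iteration ([C0_const_le]).

    Summing over the iterations bounds by [C0] the sum of the
    [2 / beta k * gap k + alpha * norm2 (res k) ^+ 2]. The ergodic weights are
    proportional to [(beta k)^-1], so Jensen's inequality for the objective
    ([econvex_weighted_mean_le]) and for the squared residual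
    ([sqr_norm2_sum_le]), together with [beta 0 <= beta k], turn this sum into
    the claimed bound at the ergodic mean. *)

(** * Euclidean norm and operator norm *)

Section EuclideanFacts.
Context {R : realType}.

Section Dot.
Context {d : nat}.
Implicit Types u v w : 'rV[R]_d.

Lemma dotC u v : dot u v = dot v u.
Proof. by apply: eq_bigr => j _; rewrite mulrC. Qed.

Lemma dotDl u v w : dot (u + v) w = dot u w + dot v w.
Proof. by rewrite -big_split; apply: eq_bigr => j _; rewrite mxE mulrDl. Qed.

Lemma dotZl a u v : dot (a *: u) v = a * dot u v.
Proof. by rewrite mulr_sumr; apply: eq_bigr => j _; rewrite mxE mulrA. Qed.

Lemma dotNl u v : dot (- u) v = - dot u v.
Proof. by rewrite -scaleN1r dotZl mulN1r. Qed.

Lemma dotBl u v w : dot (u - v) w = dot u w - dot v w.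
Proof. by rewrite dotDl dotNl. Qed.

Lemma dotDr u v w : dot u (v + w) = dot u v + dot u w.
Proof. by rewrite !(dotC u) dotDl. Qed.

Lemma dotZr a u v : dot u (a *: v) = a * dot u v.
Proof. by rewrite !(dotC u) dotZl. Qed.

Lemma dotNr u v : dot u (- v) = - dot u v.
Proof. by rewrite !(dotC u) dotNl. Qed.

Lemma dotBr u v w : dot u (v - w) = dot u v - dot u w.
Proof. by rewrite dotDr dotNr. Qed.

Lemma dot0l v : dot 0 v = 0.
Proof. by rewrite -(scale0r 0) dotZl mul0r. Qed.

Lemma dot_suml I (r : seq I) (F : I -> 'rV[R]_d) v :
  dot (\sum_(i <- r) F i) v = \sum_(i <- r) dot (F i) v.
Proof.
exact: (big_morph (fun u => dot u v) (fun _ _ => dotDl _ _ _) (dot0l v)).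
Qed.

Lemma dot_sumr I (r : seq I) (F : I -> 'rV[R]_d) v :
  dot v (\sum_(i <- r) F i) = \sum_(i <- r) dot v (F i).
Proof. by rewrite dotC dot_suml; apply: eq_bigr => i _; rewrite dotC. Qed.

Lemma dot_ge0 u : 0 <= dot u u.
Proof. by apply: sumr_ge0 => j _; rewrite -expr2 sqr_ge0. Qed.

Lemma sqr_norm2 u : norm2 u ^+ 2 = dot u u.
Proof. by rewrite sqr_sqrtr// dot_ge0. Qed.

Lemma norm2_ge0 u : 0 <= norm2 u.
Proof. exact: sqrtr_ge0. Qed.

Lemma norm2Z a u : norm2 (a *: u) = `|a| * norm2 u.
Proof. by rewrite /norm2 dotZl dotZr mulrA -expr2 sqrtrM ?sqr_ge0// sqrtr_sqr. Qed.

Lemma dot_eq0 u : dot u u = 0 -> u = 0.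
Proof.
move=> /eqP; rewrite psumr_eq0 => [/allP u0|j _]; last by rewrite -expr2 sqr_ge0.
apply/rowP => j; rewrite mxE.
by have /= := u0 j (mem_index_enum j); rewrite mulf_eq0 orbb => /eqP.
Qed.

Lemma norm2_eq0 u : norm2 u = 0 -> u = 0.
Proof.
by move=> u0; apply: dot_eq0; rewrite -sqr_norm2 u0 expr0n.
Qed.

Lemma cauchy_schwarz u v : `|dot u v| <= norm2 u * norm2 v.
Proof.
rewrite -(@ler_pXn2r _ 2) ?nnegrE ?mulr_ge0 ?norm2_ge0//.
rewrite exprMn !sqr_norm2 real_normK ?num_real//.
have [v0|v0] := eqVneq (dot v v) 0.
  by rewrite v0 (dot_eq0 v0) dotC dot0l expr0n mulr0.
have vv : 0 < dot v v by rewrite lt_neqAle eq_sym v0 dot_ge0.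
(* This vector is [dot v v] times the component of [u] orthogonal to [v]. *)
have := dot_ge0 (dot v v *: u - dot u v *: v).
rewrite !(dotBl, dotBr, dotZl, dotZr) (dotC v u).
set p := dot v v; set q := dot u v; set s := dot u u => h.
rewrite -subr_ge0 -(@pmulr_rge0 _ p)//; apply: le_trans h _.
by rewrite le_eqVlt; apply/orP; left; apply/eqP; ring.
Qed.

(** Nonnegativity of the variance of the vectors [v k] under the weights
    [w k]. *)
Lemma sqr_norm2_sum_le N (w : 'I_N -> R) (v : 'I_N -> 'rV[R]_d) :
  (forall k, 0 <= w k) -> 0 < \sum_(k < N) w k ->
  norm2 (\sum_(k < N) w k *: v k) ^+ 2 <=
  (\sum_(k < N) w k) * \sum_(k < N) w k * norm2 (v k) ^+ 2.
Proof.
move=> w0; set W := \sum_(k < N) w k => W0.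
set s := \sum_(k < N) w k *: v k.
have sE : \sum_(k < N) w k * dot (v k) s = dot s s.
  by rewrite {2}/s dot_suml; apply: eq_bigr => k _; rewrite dotZl.
have : 0 <= \sum_(k < N) w k * norm2 (W *: v k - s) ^+ 2.
  by apply: sumr_ge0 => k _; rewrite mulr_ge0// sqr_ge0.
under eq_bigr => k _.
  rewrite sqr_norm2 !(dotBl, dotBr, dotZl, dotZr) (dotC s (v k)) -sqr_norm2.
  rewrite (_ : _ * _ = W ^+ 2 * (w k * norm2 (v k) ^+ 2)
    - 2 * W * (w k * dot (v k) s) + w k * dot s s); last by ring.
  over.
rewrite !big_split/= sumrN -!mulr_sumr -mulr_suml sE sqr_norm2 -/W => h.
rewrite -subr_ge0 -(@pmulr_rge0 _ W)//; apply: le_trans h _.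
by rewrite le_eqVlt; apply/orP; left; apply/eqP; ring.
Qed.

Lemma sqr_norm2_sum_card_le N (v : 'I_N -> 'rV[R]_d) :
  norm2 (\sum_(k < N) v k) ^+ 2 <= N%:R * \sum_(k < N) norm2 (v k) ^+ 2.
Proof.
case: N v => [|N] v; first by rewrite !big_ord0 sqr_norm2 dot0l mulr0.
have W : \sum_(k < N.+1) 1 = N.+1%:R :> R by rewrite sumr_const card_ord.
have := @sqr_norm2_sum_le N.+1 (fun=> 1) v (fun=> ler01).
rewrite W; under eq_bigr do rewrite scale1r; under [in leRHS]eq_bigr do rewrite mul1r.
by apply; rewrite ltr0n.
Qed.

End Dot.

Section Opnorm.
Context {d m : nat}.
Variable A : {linear 'rV[R]_d -> 'rV[R]_m}.

(** The supremum defining [opnorm A] is over a bounded set: the columns of the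
    matrix of [A] give a bound, by Cauchy-Schwarz in each coordinate. *)
Lemma norm2_linear_bounded : exists C, forall u, norm2 (A u) <= C * norm2 u.
Proof.
pose c := \sum_(j < m) norm2 (col j (lin1_mx A))^T ^+ 2.
have c0 : 0 <= c by apply: sumr_ge0 => j _; exact: sqr_ge0.
exists (Num.sqrt c) => u.
rewrite -(@ler_pXn2r _ 2) ?nnegrE ?mulr_ge0 ?norm2_ge0 ?sqrtr_ge0//.
rewrite exprMn (sqr_sqrtr c0) [in leLHS]sqr_norm2 mulr_suml; apply: ler_sum => j _.
rewrite -expr2 -(mul_rV_lin1 A).
rewrite (_ : (u *m lin1_mx A) 0 j = dot u (col j (lin1_mx A))^T); last first.
  by rewrite mxE; apply: eq_bigr => k _; rewrite !mxE.
rewrite -real_normK ?num_real// -exprMn ler_pXn2r ?nnegrE ?mulr_ge0 ?norm2_ge0//.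
by rewrite mulrC cauchy_schwarz.
Qed.

Lemma norm2_linear_le u : norm2 (A u) <= opnorm A * norm2 u.
Proof.
have [C hC] := norm2_linear_bounded.
have [u0|u0] := eqVneq (norm2 u) 0.
  by rewrite u0 mulr0 (norm2_eq0 u0) linear0 /norm2 dot0l sqrtr0.
have up : 0 < norm2 u by rewrite lt_neqAle eq_sym u0 norm2_ge0.
rewrite -ler_pdivrMr// mulrC -[(norm2 u)^-1]ger0_norm ?invr_ge0 ?norm2_ge0//.
rewrite -norm2Z -linearZ; apply: ub_le_sup.
  exists `|C| => _ [v /= v1 <-]; apply: (le_trans (hC v)).
  apply: (@le_trans _ _ (`|C| * norm2 v)).
    by rewrite ler_wpM2r ?norm2_ge0// ler_norm.
  by rewrite -[leRHS]mulr1 ler_wpM2l.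
exists ((norm2 u)^-1 *: u) => //=.
by rewrite norm2Z ger0_norm ?invr_ge0 ?norm2_ge0// mulVf.
Qed.

Lemma sqr_norm2_linear_le u :
  norm2 (A u) ^+ 2 <= opnorm A ^+ 2 * norm2 u ^+ 2.
Proof.
rewrite -exprMn lerXn2r ?nnegrE ?norm2_ge0 ?norm2_linear_le//.
exact: le_trans (norm2_ge0 _) (norm2_linear_le u).
Qed.

End Opnorm.

End EuclideanFacts.

(** * Convex functions with Lipschitz gradient *)

Section SmoothConvex.
Context {R : realType}.

(** The limit [t -> 0] in a first-order inequality; this replaces one-sided
    derivatives along segments. *)
Lemma le_of_le_addM (a b c : R) :
  (forall t, 0 < t -> t <= 1 -> a <= b + t * c) -> a <= b.
Proof.
move=> h; apply/ler_addgt0Pr => e e0.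
have c1 : 0 < `|c| + 1 by rewrite ltr_wpDl.
pose t := Num.min 1 (e / (`|c| + 1)).
have t0 : 0 < t by rewrite lt_min ltr01 divr_gt0.
have t1 : t <= 1 by rewrite ge_min lexx.
apply: (le_trans (h t t0 t1)); rewrite lerD2l.
apply: (@le_trans _ _ (t * (`|c| + 1))).
  by rewrite ler_pM2l// (le_trans (ler_norm c))// lerDl.
by rewrite -ler_pdivlMr// ge_min lexx orbT.
Qed.

(** Subtracting the polynomial [dphi 0 * t + c / 2 * t ^+ 2] leaves a function
    with nonpositive derivative, to which the mean value theorem applies. *)
Lemma le_quadratic_of_derive (phi dphi : R -> R) (c : R) :
  (forall t : R, is_derive t (1 : R) phi (dphi t)) ->
  (forall t, 0 < t -> dphi t - dphi 0 <= c * t) ->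
  phi 1 <= phi 0 + dphi 0 + c / 2.
Proof.
move=> dphiE dle.
pose q : {poly R} := dphi 0 *: 'X + (c / 2) *: 'X^2.
pose psi : R -> R := phi - horner q.
have dpsi (t : R) : is_derive t (1 : R) psi (dphi t - (dphi 0 + c * t)).
  have := is_deriveB (dphiE t) (is_derive_poly q t).
  rewrite derivD !derivZ derivX derivXn/= !hornerE /= => h.
  by apply: is_derive_eq; field.
have cpsi : {within `[0, 1], continuous psi}.
  apply: derivable_within_continuous => t _; by have [] := dpsi t.
have [t] := MVT ltr01 (fun t _ => dpsi t) cpsi.
rewrite in_itv/= => /andP[t0 _].
have -> : psi 1 = phi 1 - (dphi 0 + c / 2).
  by rewrite /psi !fctE !hornerE/=; congr (_ - _); ring.
have -> : psi 0 = phi 0 by rewrite /psi !fctE !hornerE /=; ring.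
by have := dle t t0; rewrite subr0 mulr1; lra.
Qed.

Section Gradient.
Context {d : nat}.
Variable g : 'rV[R]_d -> R^o.
Hypothesis g_diff : forall x, differentiable g x.

Lemma is_derive_line (x u : 'rV[R]_d) (t : R) :
  is_derive t (1 : R) (fun s : R => g (x + s *: u) : R)
    (dot (gradient g (x + t *: u)) u).
Proof.
have := @diff_derivable _ _ _ g (x + t *: u) u (@g_diff _).
have -> : dot (gradient g (x + t *: u)) u = 'D_u g (x + t *: u).
  by rewrite deriveE// gradientP.
move=> dg.
have quotE : (fun s : R => s^-1 *: (((fun r : R => g (x + r *: u)) \o shift t)
      (s *: (1 : R)) - g (x + t *: u))) =
    (fun s : R => s^-1 *: ((g \o shift (x + t *: u)) (s *: u) - g (x + t *: u))).
  apply/funext => s /=; congr (_ *: (g _ - _)).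
  by rewrite [s *: (1 : R)]mulr1 scalerDl addrCA.
by split; rewrite /derivable /derive quotE.
Qed.

Variable T : R.
Hypothesis g_lip : forall x y,
  norm2 (gradient g x - gradient g y) <= T * norm2 (x - y).

Lemma dot_gradient_increment_le (x u : 'rV[R]_d) (t : R) : 0 < t ->
  `|dot (gradient g (x + t *: u)) u - dot (gradient g x) u| <=
  T * norm2 u ^+ 2 * t.
Proof.
move=> t0; rewrite -dotBl; apply: (le_trans (cauchy_schwarz _ _)).
have := g_lip (x + t *: u) x.
rewrite addrAC subrr add0r norm2Z gtr0_norm// => h.
apply: (le_trans (ler_wpM2r (norm2_ge0 u) h)).
by rewrite le_eqVlt; apply/orP; left; apply/eqP; ring.
Qed.

Lemma smooth_le_quadratic (x y : 'rV[R]_d) :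
  g y <= g x + dot (gradient g x) (y - x) + T / 2 * norm2 (y - x) ^+ 2.
Proof.
set u := y - x; have xuE : x + u = y by rewrite addrC subrK.
have := @le_quadratic_of_derive (fun s => g (x + s *: u)) _
  (T * norm2 u ^+ 2) (is_derive_line x u).
rewrite scale1r scale0r addr0 xuE => h.
rewrite [_ / 2 * _]mulrAC; apply: h => t t0.
exact: le_trans (ler_norm _) (dot_gradient_increment_le _ _ t0).
Qed.

(** The same estimate for [- g] along the segment. *)
Lemma smooth_ge_quadratic (x y : 'rV[R]_d) :
  g x + dot (gradient g x) (y - x) - T / 2 * norm2 (y - x) ^+ 2 <= g y.
Proof.
set u := y - x; have xuE : x + u = y by rewrite addrC subrK.
have dN t := is_deriveN (is_derive_line x u t).
have := @le_quadratic_of_derive _ _ (T * norm2 u ^+ 2) dN.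
rewrite !fctE scale1r scale0r addr0 xuE => h.
rewrite [_ / 2 * _]mulrAC.
suff /h : forall t : R, 0 < t -> - dot (gradient g (x + t *: u)) u
    - - dot (gradient g x) u <= T * norm2 u ^+ 2 * t by lra.
move=> t t0; apply: le_trans (dot_gradient_increment_le _ _ t0).
by rewrite -opprD -[_ + _]opprK opprK lerNl lerNnormlW.
Qed.

(** The segment from [x] to [y] gives
    [t (g y - g x) >= g (x + t (y - x)) - g x], and the quadratic minorant of
    [g] at [x] bounds the right-hand side up to [O(t^2)]. *)
Lemma convex_ge_tangent (x y : 'rV[R]_d) :
  convex_function setT g -> g x + dot (gradient g x) (y - x) <= g y.
Proof.
move=> g_conv; apply: (@le_of_le_addM _ _ (T / 2 * norm2 (y - x) ^+ 2)) => t t0 t1.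
have := g_conv (Itv01 (ltW t0) t1) y x.
rewrite !inE => /(_ I I); rewrite convRE.
have -> : conv (Itv01 (ltW t0) t1) (y : convex_lmodType _) x = x + t *: (y - x).
  rewrite /conv/= /unstable.onem scalerBl scale1r scalerBr addrC -addrA; congr (_ + _).
  by rewrite addrC.
have := smooth_ge_quadratic x (x + t *: (y - x)).
have -> : x + t *: (y - x) - x = t *: (y - x) by rewrite addrAC subrr add0r.
rewrite norm2Z gtr0_norm// dotZr /= /unstable.onem.
set n := norm2 _; set e := dot _ _; set gt := g _ => h1 h2.
rewrite -(ler_pM2l t0); nra.
Qed.

(** The descent lemma at [x] combined with the tangent inequality at [x]. *)
Lemma smooth_convex_three_point (x y z : 'rV[R]_d) :
  convex_function setT g ->
  g y <= g z + dot (gradient g x) (y - z) + T / 2 * norm2 (y - x) ^+ 2.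
Proof.
move=> g_conv; have := smooth_le_quadratic x y.
have := convex_ge_tangent x z g_conv.
rewrite !dotBr; lra.
Qed.

End Gradient.
End SmoothConvex.

(** * Extended-real convex functions and the proximal step *)

Section ExtendedConvex.
Context {R : realType} {d : nat}.
Implicit Types (f h : 'rV[R]_d -> \bar R) (x y z v : 'rV[R]_d).

Lemma econvex_le f x y (r s t : R) : econvex f -> 0 <= t -> t <= 1 ->
  (f x <= r%:E)%E -> (f y <= s%:E)%E ->
  (f (t *: x + (1 - t) *: y)%R <= (t * r + (1 - t) * s)%:E)%E.
Proof.
move=> fc t0 t1 fx fy.
have := fc (x, r) (y, s) (Itv01 t0 t1).
by rewrite !inE; exact.
Qed.

(** Jensen's inequality with unnormalized weights, so that the induction only
    has to combine the mean of the first [N.+1] points with the last point,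
    with coefficients [W / (W + a)] and [a / (W + a)]. *)
Lemma econvex_weighted_mean_le f (N : nat) (w : nat -> R)
    (x : nat -> 'rV[R]_d) (r : nat -> R) :
  econvex f -> (forall k, 0 < w k) -> (forall k, (f (x k) <= (r k)%:E)%E) ->
  (f (\sum_(k < N.+1) (w k / \sum_(j < N.+1) w j) *: x k)%R <=
   (\sum_(k < N.+1) w k / (\sum_(j < N.+1) w j) * r k)%R%:E)%E.
Proof.
move=> fc w0 fr; elim: N => [|N IH].
  by rewrite !big_ord1 divff ?gt_eqF// scale1r mul1r.
have W0 : 0 < \sum_(j < N.+1) w j.
  by rewrite big_ord_recr/= ltr_wpDl// sumr_ge0// => k _; exact: ltW.
rewrite !(big_ord_recr N.+1)/=.
set W := \sum_(j < N.+1) w j in IH W0 *; set a := w N.+1.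
have a0 : 0 < a by exact: w0.
have V0 : 0 < W + a by rewrite addr_gt0.
have t0 : 0 <= W / (W + a) by rewrite divr_ge0// ltW.
have t1 : W / (W + a) <= 1 by rewrite ler_pdivrMr// mul1r lerDl ltW.
have tE : 1 - W / (W + a) = a / (W + a).
  by field; rewrite gt_eqF.
have wE k : w k / (W + a) = W / (W + a) * (w k / W).
  by field; rewrite !gt_eqF.
have -> : \sum_(k < N.+1) (w k / (W + a)) *: x k =
    (W / (W + a)) *: \sum_(k < N.+1) (w k / W) *: x k.
  by rewrite scaler_sumr; apply: eq_bigr => k _; rewrite scalerA -wE.
have -> : \sum_(k < N.+1) w k / (W + a) * r k =
    W / (W + a) * \sum_(k < N.+1) w k / W * r k.
  by rewrite mulr_sumr; apply: eq_bigr => k _; rewrite mulrA -wE.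
by have := econvex_le fc t0 t1 IH (fr N.+1); rewrite tE.
Qed.

(** First-order optimality of a proximal step. Comparing the minimizer [xp]
    with the points [t y + (1 - t) xp] of the segment towards [y] gives the
    subgradient inequality up to a term linear in [t]. *)
Lemma prox_subgradient h x v xp (tau : R) : Defs.proper h -> econvex h -> 0 < tau ->
  argmin (fun y => h y +
    (tau / 2 * norm2 (y - x + tau^-1 *: v)%R ^+ 2)%:E)%E xp ->
  subdifferential h xp (- (tau *: (xp - x) + v)).
Proof.
move=> [[y0 hy0] hNy] hc tau0 hmin y.
have hp_fin : h xp \is a fin_num.
  have := hmin y0; move: hy0 (hNy xp); rewrite fin_numE.
  by case: (h xp) => [r|//|//]; case: (h y0) => [s|//|//].
move: hp_fin => /fineK; set hr := fine _ => hrE.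
case E : (h y) => [r| |]; last 2 first.
- by rewrite leey.
- by have := hNy y; rewrite E.
rewrite -hrE -EFinD lee_fin.
set p := xp - x + tau^-1 *: v; set u := y - xp.
have pE : tau *: (xp - x) + v = tau *: p.
  by rewrite [in RHS]scalerDr scalerA divff ?gt_eqF// scale1r.
rewrite pE dotNl dotZl lerBlDr.
apply: (@le_of_le_addM _ _ _ (tau / 2 * norm2 u ^+ 2)) => t t0 t1.
have hyr : (h y <= r%:E)%E by rewrite E.
have hxr : (h xp <= hr%:E)%E by rewrite hrE.
have := le_trans (hmin _) (leeD2r _ (econvex_le hc (ltW t0) t1 hyr hxr)).
rewrite -/p -hrE -!EFinD lee_fin.
have -> : t *: y + (1 - t) *: xp - x + tau^-1 *: v = p + t *: u.
  rewrite /p /u scalerBl scale1r scalerBr.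
  by rewrite [in RHS]addrC !addrA; congr (_ + _); rewrite -!addrA; congr (_ + _); rewrite addrCA.
clearbody p u; rewrite !sqr_norm2 !(dotDl, dotDr, dotZl, dotZr) (dotC u p).
set pp := dot p p; set pu := dot p u; set uu := dot u u => h1.
rewrite -(ler_pM2l t0); lra.
Qed.

End ExtendedConvex.

(** One block of the iteration, measured against an arbitrary point [z]: the
    subgradient inequality for [h] at [xp] plus the three-point inequality
    for [g]; the two gradient terms [gradient g x] cancel. *)
Lemma prox_gradient_step_le (R : realType) (d : nat) (g : 'rV[R]_d -> R^o)
    (h : 'rV[R]_d -> \bar R) (T tau hp hz : R) (x xp z v : 'rV[R]_d) :
  (forall x, differentiable g x) -> convex_function setT g ->
  (forall x y, norm2 (gradient g x - gradient g y) <= T * norm2 (x - y)) ->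
  h xp = hp%:E -> h z = hz%:E ->
  subdifferential h xp (- (tau *: (xp - x) + (v + gradient g x))) ->
  g xp + hp <= g z + hz + dot v (z - xp)
    + tau / 2 * (norm2 (x - z) ^+ 2 - norm2 (xp - z) ^+ 2)
    - (tau - T) / 2 * norm2 (xp - x) ^+ 2.
Proof.
move=> g_diff g_conv g_lip hpE hzE /(_ z); rewrite hpE hzE -EFinD lee_fin.
have := smooth_convex_three_point g_diff g_lip x xp z g_conv.
rewrite !sqr_norm2 !(dotBl, dotBr, dotNl, dotNr, dotDl, dotZl).
rewrite (dotC z x) (dotC z xp) (dotC xp x); lra.
Qed.

(** * Decrease along one iteration *)

Section Iteration.
Context {R : realType} {n m : nat} {d : 'I_n -> nat}.
Implicit Type A : forall i, {linear 'rV[R]_(d i) -> 'rV[R]_m}.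

Lemma adjointB k l (B : {linear 'rV[R]_k -> 'rV[R]_l}) u v :
  adjoint B (u - v) = adjoint B u - adjoint B v.
Proof. by rewrite /adjoint mulmxBl. Qed.

Lemma constraint_mapB A (x y : forall i, 'rV[R]_(d i)) :
  constraint_map A x - constraint_map A y = \sum_(i < n) A i (x i - y i).
Proof. by rewrite -sumrB; apply: eq_bigr => i _; rewrite linearB. Qed.

(** Four-point identity for [lam], [lams], the predicted multiplier
    [lam + beta *: r] and the updated multiplier [lam + beta *: rp]. *)
Lemma dot_multiplier_step (lam lams r rp : 'rV[R]_m) (beta : R) :
  2 * beta * dot (lam + beta *: r - lams) rp =
  norm2 (lam + beta *: rp - lams) ^+ 2 - norm2 (lam - lams) ^+ 2
  + beta ^+ 2 * (norm2 r ^+ 2 - norm2 (rp - r) ^+ 2).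
Proof.
rewrite !sqr_norm2 !(dotBl, dotBr, dotDl, dotDr, dotZl, dotZr).
rewrite (dotC lams lam) (dotC rp lam) (dotC rp r) (dotC lams rp); ring.
Qed.

Section Constants.
Variables (A : forall i, {linear 'rV[R]_(d i) -> 'rV[R]_m}) (eta : 'I_n -> R).
Hypothesis eta_gt : forall i, n%:R * opnorm (A i) ^+ 2 < eta i.

Let M := \big[Num.max/1]_(i < n)
     (opnorm (A i) ^+ 2 / (eta i - n%:R * opnorm (A i) ^+ 2)).

Let M_ge1 : 1 <= M.
Proof. exact: bigmax_ge_id. Qed.

Lemma alpha_const_gt0 : 0 < alpha_const A eta.
Proof. by rewrite invr_gt0 mulr_gt0 ?ltr0n// (lt_le_trans ltr01). Qed.

(** [alpha] is the constant of this estimate: the new residual is a sum of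
    [n + 1] vectors, and the maximum in [alpha] compares each
    [opnorm (A i) ^+ 2] with the margin [eta i - n * opnorm (A i) ^+ 2]. *)
Lemma alpha_residual_le (r : 'rV[R]_m) (u : forall i, 'rV[R]_(d i)) :
  alpha_const A eta * norm2 (r + constraint_map A u) ^+ 2 <=
  norm2 r ^+ 2
  + \sum_(i < n) (eta i - n%:R * opnorm (A i) ^+ 2) * norm2 (u i) ^+ 2.
Proof.
have M0 : 0 < M by exact: lt_le_trans ltr01 M_ge1.
rewrite mulrC ler_pdivrMr ?mulr_gt0 ?ltr0n// mulrC.
pose v (k : 'I_n.+1) := oapp (fun i => A i (u i)) r (unlift ord0 k).
have vE : r + constraint_map A u = \sum_(k < n.+1) v k.
  rewrite big_ord_recl /v unlift_none/=; congr (_ + _).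
  by apply: eq_bigr => i _; rewrite liftK.
rewrite vE; apply: (le_trans (sqr_norm2_sum_card_le v)).
rewrite -mulrA ler_pM2l ?ltr0n// big_ord_recl {1}/v unlift_none/=.
rewrite mulrDr lerD//; first by rewrite ler_peMl ?sqr_ge0.
rewrite mulr_sumr; apply: ler_sum => i _; rewrite /v liftK/=.
apply: (le_trans (sqr_norm2_linear_le (A i) (u i))).
rewrite [leRHS]mulrA ler_wpM2r ?sqr_ge0// -ler_pdivrMr ?subr_gt0//.
by rewrite /M (le_bigmax 1 (fun i => _ / _) i).
Qed.

End Constants.

(** Monotone in the penalty because the weights of [C0_const] are
    [T i / beta + eta i] and [beta ^- 2]. *)
Lemma C0_const_le (T eta : 'I_n -> R) (beta : nat -> R) k
    (x xs : forall i, 'rV[R]_(d i)) (lam lams : 'rV[R]_m) :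
  (forall i, 0 < T i) -> (forall k, 0 < beta k) -> nondecreasing_seq beta ->
  C0_const (beta k.+1) (ladm_tau T eta beta k.+1) x xs lam lams <=
  C0_const (beta k) (ladm_tau T eta beta k) x xs lam lams.
Proof.
move=> T0 beta0 beta_nd.
have bV : (beta k.+1)^-1 <= (beta k)^-1.
  by rewrite lef_pV2 ?posrE//; exact: beta_nd.
have tauE l i : (beta l)^-1 * ladm_tau T eta beta l i = (beta l)^-1 * T i + eta i.
  by rewrite /ladm_tau mulrDr mulKf// gt_eqF.
rewrite /C0_const lerD//.
  apply: ler_sum => i _; rewrite ler_wpM2r ?sqr_ge0// !tauE lerD2r.
  by rewrite ler_wpM2r// ltW.
by rewrite ler_wpM2r ?sqr_ge0// -!exprVn lerXn2r// nnegrE invr_ge0 ltW.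
Qed.

Section Step.
Variables (g : forall i, 'rV[R]_(d i) -> R^o) (h : forall i, 'rV[R]_(d i) -> \bar R).
Variables (A : forall i, {linear 'rV[R]_(d i) -> 'rV[R]_m}) (b : 'rV[R]_m).
Variables (T eta : 'I_n -> R).
Hypothesis g_convex : forall i, convex_function setT (@g i).
Hypothesis g_diff : forall i x, differentiable (@g i) x.
Hypothesis g_lip : forall i x y,
  norm2 (gradient (@g i) x - gradient (@g i) y) <= T i * norm2 (x - y).
Hypothesis h_convex : forall i, econvex (@h i).
Hypothesis h_proper : forall i, Defs.proper (@h i).
Hypothesis T_gt0 : forall i, 0 < T i.
Hypothesis eta_gt0 : forall i, 0 < eta i.
Hypothesis eta_gt : forall i, n%:R * opnorm (A i) ^+ 2 < eta i.

Variables (beta : R) (x xp xs : forall i, 'rV[R]_(d i)) (lam lams : 'rV[R]_m).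
Hypothesis beta_gt0 : 0 < beta.
Hypothesis xs_feasible : constraint_map A xs = b.
Let tau i := T i + beta * eta i.
Let r := constraint_map A x - b.
Let rp := constraint_map A xp - b.
Hypothesis xp_argmin : forall i,
  argmin (@prox_objective R n m d g h A i (tau i) (x i) (lam + beta *: r)) (xp i).
Variables (F Fs : 'I_n -> R).
Hypothesis FE : forall i, objective g h (xp i) = (F i)%:E.
Hypothesis FsE : forall i, objective g h (xs i) = (Fs i)%:E.

Let gap := \sum_(i < n) (F i - Fs i + dot (adjoint (A i) lams) (xp i - xs i)).

Let block_le i :
  F i - Fs i + dot (adjoint (A i) lams) (xp i - xs i) <=
  tau i / 2 * (norm2 (x i - xs i) ^+ 2 - norm2 (xp i - xs i) ^+ 2)
  - beta * eta i / 2 * norm2 (xp i - x i) ^+ 2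
  - dot (lam + beta *: r - lams) (A i (xp i - xs i)).
Proof.
have tau0 : 0 < tau i by rewrite addr_gt0// mulr_gt0.
have hE y c : objective g h y = c%:E -> @h i y = (c - @g i y)%:E.
  by rewrite /objective EFinB => <-; rewrite [(_ + h _)%E]addeC addeK.
have := prox_gradient_step_le (@g_diff i) (@g_convex i) (@g_lip i)
  (hE _ _ (FE i)) (hE _ _ (FsE i))
  (prox_subgradient (h_proper i) (@h_convex i) tau0 (@xp_argmin i)).
rewrite !subrKC -adjointP adjointB /tau.
rewrite !(dotBr, dotBl); lra.
Qed.

(** The weights of [C0_const] stay at the current penalty here; only the points
    move. The cross term [norm2 (rp - r)] left by the multiplier
    update is absorbed by the proximal terms since
    [eta i > n * opnorm (A i) ^+ 2]. *)
Lemma lyapunov_decrease :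
  2 * beta^-1 * gap + alpha_const A eta * norm2 rp ^+ 2 <=
  C0_const beta tau x xs lam lams
  - C0_const beta tau xp xs (lam + beta *: rp) lams.
Proof.
have gap_le : gap <= \sum_(i < n)
    (tau i / 2 * (norm2 (x i - xs i) ^+ 2 - norm2 (xp i - xs i) ^+ 2)
    - beta * eta i / 2 * norm2 (xp i - x i) ^+ 2)
    - dot (lam + beta *: r - lams) rp.
  rewrite /rp -xs_feasible constraint_mapB dot_sumr -sumrB.
  by apply: ler_sum => i _; exact: block_le.
pose u i := xp i - x i.
have rpE : rp - r = constraint_map A u.
  rewrite /rp /r opprB addrA subrK constraint_mapB.
  by apply: eq_bigr.
have rp_le : norm2 (rp - r) ^+ 2 <=
    \sum_(i < n) n%:R * opnorm (A i) ^+ 2 * norm2 (u i) ^+ 2.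
  rewrite rpE; apply: (le_trans (sqr_norm2_sum_card_le _)).
  rewrite mulr_sumr; apply: ler_sum => i _.
  by rewrite -mulrA ler_wpM2l ?ler0n// sqr_norm2_linear_le.
have := alpha_residual_le eta_gt r u; rewrite -rpE [r + _]addrC subrK => alpha_le.
have dotE := dot_multiplier_step lam lams r rp beta.
pose S y := \sum_(i < n) tau i * norm2 (y i - xs i) ^+ 2.
pose D := \sum_(i < n) eta i * norm2 (u i) ^+ 2.
have C0E y l : C0_const beta tau y xs l lams =
    beta^-1 * S y + beta^-1 ^+ 2 * norm2 (l - lams) ^+ 2.
  rewrite /C0_const mulr_sumr exprVn; congr (_ + _).
  by apply: eq_bigr => i _; rewrite -mulrA.
rewrite !C0E.
have sumE : \sum_(i < n)
    (tau i / 2 * (norm2 (x i - xs i) ^+ 2 - norm2 (xp i - xs i) ^+ 2)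
    - beta * eta i / 2 * norm2 (xp i - x i) ^+ 2) =
    (S x - S xp - beta * D) / 2.
  rewrite /S /D mulr_sumr -!sumrB mulr_suml; apply: eq_bigr => i _; rewrite /u.
  by field.
have DE : \sum_(i < n) (eta i - n%:R * opnorm (A i) ^+ 2) * norm2 (u i) ^+ 2 =
    D - \sum_(i < n) n%:R * opnorm (A i) ^+ 2 * norm2 (u i) ^+ 2.
  by rewrite /D -sumrB; apply: eq_bigr => i _; rewrite mulrBl.
rewrite sumE in gap_le; rewrite DE in alpha_le.
have betaV : 0 <= 2 * beta^-1 by rewrite mulr_ge0 ?invr_ge0// ltW.
have {}gap_le := ler_wpM2l betaV gap_le.
have expandE : 2 * beta^-1 * ((S x - S xp - beta * D) / 2
      - dot (lam + beta *: r - lams) rp) =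
    beta^-1 * (S x - S xp) - D
    - beta^-1 ^+ 2 * (2 * beta * dot (lam + beta *: r - lams) rp).
  by field; rewrite gt_eqF.
have cancelE (p q : R) :
    beta^-1 ^+ 2 * (p + beta ^+ 2 * q) = beta^-1 ^+ 2 * p + q.
  by field; rewrite gt_eqF.
rewrite expandE dotE cancelE in gap_le.
by lra.
Qed.

End Step.
End Iteration.

(** * Ergodic convergence rate *)

Lemma sum_le_of_decrease (R : realType) (a P : nat -> R) (N : nat) :
  (forall k, a k <= P k - P k.+1) -> 0 <= P N ->
  \sum_(k < N) a k <= P 0%N.
Proof.
move=> aP PN; suff : \sum_(k < N) a k <= P 0%N - P N by lra.
elim: N {PN} => [|N IH]; first by rewrite big_ord0 subrr.
by rewrite big_ord_recr/=; have := aP N; lra.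
Qed.

Lemma proper_nonsmooth_part (R : realType) (d : nat) (g : 'rV[R]_d -> R^o)
    (h : 'rV[R]_d -> \bar R) :
  Defs.proper (fun x => (g x)%:E + h x)%E -> Defs.proper h.
Proof.
move=> [[x fx] fN]; split => [|y]; first exists x.
  by move: fx; case: (h x) => [r||]; rewrite ?ltry ?ltNyr.
by have := fN y; case: (h y) => [r||]; rewrite ?ltNyr.
Qed.

Theorem theorem7 (R : realType) (n m : nat) (d : 'I_n -> nat)
  (g : forall i, 'rV[R]_(d i) -> R^o)
  (h : forall i, 'rV[R]_(d i) -> \bar R)
  (A : forall i, {linear 'rV[R]_(d i) -> 'rV[R]_m})
  (b : 'rV[R]_m) (L : 'I_n -> R)
  (g_convex : forall i, convex_function setT (g i))
  (g_diff : forall i x, differentiable (g i) x)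
  (g_grad_lip : forall i x y,
     norm2 (gradient (g i) x - gradient (g i) y) <= L i * norm2 (x - y))
  (h_convex : forall i, econvex (h i))
  (f_cpc : forall i, closed_proper_convex (@objective R n d g h i))
  (A_neq0 : forall i, exists u, A i u <> 0)
  (sol_nonunique : exists x y : forall i, 'rV[R]_(d i),
     [/\ constraint_map A x = b, constraint_map A y = b &
         exists i, x i <> y i])
  (A_onto : forall v : 'rV[R]_m,
     exists x : forall i, 'rV[R]_(d i), constraint_map A x = v)
  (xs : forall i, 'rV[R]_(d i)) (lams : 'rV[R]_m)
  (kkt : KKT_point g h A b xs lams)
  (beta : nat -> R) (T eta : 'I_n -> R)
  (beta_gt0 : forall k, 0 < beta k)
  (beta_nd : nondecreasing_seq beta)
  (T_gt0 : forall i, 0 < T i) (T_ge : forall i, L i <= T i)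
  (eta_gt0 : forall i, 0 < eta i)
  (eta_gt : forall i, n%:R * opnorm (A i) ^+ 2 < eta i)
  (x : nat -> forall i, 'rV[R]_(d i)) (lam : nat -> 'rV[R]_m)
  (gen : prox_LADMPSAP g h A b beta (ladm_tau T eta beta) x lam)
  (K : nat) :
  let f := objective g h in
  let xbar := ergodic_mean beta x K in
  let alpha := alpha_const A eta in
  let C0 := C0_const (beta 0%N) (ladm_tau T eta beta 0) (x 0%N) xs (lam 0%N) lams in
  ((\sum_(i < n) (f i (xbar i) - f i (xs i)
                  + (dot (adjoint (A i) lams) (xbar i - xs i)%R)%:E)
    + (alpha * beta 0%N / 2 * norm2 (constraint_map A xbar - b) ^+ 2)%:E)
   <= (C0 / (2 * \sum_(k < K.+1) (beta k)^-1))%:E)%E.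
Proof.
(* The [let]s sit below the coercion [is_true], out of reach of [move=>]. *)
lazy zeta; set f := objective g h; set xbar := ergodic_mean beta x K.
set alpha := alpha_const A eta.
have h_proper i : Defs.proper (h i).
  by have [_ /proper_nonsmooth_part] := f_cpc i.
have f_proper i : Defs.proper (@objective R n d g h i).
  by have [] := f_cpc i.
have f_econvex i : econvex (@objective R n d g h i).
  by have [] := f_cpc i.
have [xs_feasible xs_opt] := kkt.
have g_lip i y z : norm2 (gradient (g i) y - gradient (g i) z) <=
    T i * norm2 (y - z).
  by apply: (le_trans (g_grad_lip i y z)); rewrite ler_wpM2r ?norm2_ge0.
have tau_gt0 k i : 0 < ladm_tau T eta beta k i by rewrite addr_gt0// mulr_gt0.
(* Optimality of [xs i], and minimality of [x k.+1 i], compare their values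
   with the value at a point of the domain, hence finiteness. *)
have fin_of_lt i y : (f i y < +oo)%E -> f i y = (fine (f i y))%:E.
  by move=> fy; rewrite fineK// fin_numElt fy andbT; exact: (f_proper i).2.
pose Fs i := fine (f i (xs i)).
have FsE i : f i (xs i) = (Fs i)%:E.
  apply: fin_of_lt; have [[y fy] _] := f_proper i.
  have := le_lt_trans (xs_opt i y) fy.
  by rewrite /f; case: (objective g h (xs i)) => [r||]; rewrite ?ltry.
pose F k i := fine (f i (x k.+1 i)).
have FE k i : f i (x k.+1 i) = (F k i)%:E.
  apply: fin_of_lt; have [xp_argmin _] := gen k.
  have [[y hy] _] := h_proper i.
  have := xp_argmin i y; rewrite /prox_objective /f /objective.
  move: hy; case: (h i y) => [s|//|] _; case: (h i (x k.+1 i)) => [r|//|] //.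
    by move=> _; rewrite -EFinD ltry.
pose res k := constraint_map A (x k.+1) - b.
pose gap k := \sum_(i < n)
  (F k i - Fs i + dot (adjoint (A i) lams) (x k.+1 i - xs i)).
pose P k := C0_const (beta k) (ladm_tau T eta beta k) (x k) xs (lam k) lams.
have decrease k :
    2 * (beta k)^-1 * gap k + alpha * norm2 (res k) ^+ 2 <= P k - P k.+1.
  have [xp_argmin lamE] := gen k.
  have step := lyapunov_decrease g_convex g_diff g_lip h_convex h_proper T_gt0
    eta_gt0 eta_gt lams (beta_gt0 k) xs_feasible xp_argmin (FE k) FsE.
  apply: (le_trans step); rewrite -lamE lerD2l lerN2.
  exact: C0_const_le.
have P_ge0 k : 0 <= P k.
  rewrite addr_ge0//; first apply: sumr_ge0 => i _.
    by rewrite mulr_ge0 ?sqr_ge0// mulr_ge0 ?invr_ge0 ?(ltW (beta_gt0 _))// ltW.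
  by rewrite mulr_ge0 ?sqr_ge0// invr_ge0 exprn_ge0// ltW.
have sum_le := sum_le_of_decrease decrease (P_ge0 K.+1).
set S := \sum_(k < K.+1) (beta k)^-1.
have S_gt0 : 0 < S.
  rewrite /S big_ord_recl ltr_pwDl ?invr_gt0//.
  by apply: sumr_ge0 => k _; rewrite invr_ge0 ltW.
pose w k := gamma_weight beta K k.
have w_ge0 k : 0 <= w k by rewrite mulr_ge0 ?invr_ge0// ltW.
have w_sum : \sum_(k < K.+1) w k = 1 by rewrite -mulr_suml divff// gt_eqF.
have f_mean i : (f i (xbar i) <= (\sum_(k < K.+1) w k * F k i)%:E)%E.
  apply: (@econvex_weighted_mean_le _ _ _ K (fun k => (beta k)^-1)
    (fun k => x k.+1 i) (F ^~ i)) => // k; first by rewrite invr_gt0.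
  by rewrite FE.
pose Fb i := fine (f i (xbar i)).
have FbE i : f i (xbar i) = (Fb i)%:E.
  by apply: fin_of_lt; exact: le_lt_trans (f_mean i) (ltry _).
have Fb_le i : Fb i <= \sum_(k < K.+1) w k * F k i.
  by have := f_mean i; rewrite FbE lee_fin.
have resE : constraint_map A xbar - b = \sum_(k < K.+1) w k *: res k.
  under [RHS]eq_bigr do rewrite scalerBr.
  rewrite sumrB -scaler_suml w_sum scale1r; congr (_ - _).
  under [RHS]eq_bigr do rewrite scaler_sumr.
  rewrite exchange_big; apply: eq_bigr => i _.
  by rewrite linear_sum; apply: eq_bigr => k _; rewrite linearZ.
have res_mean : norm2 (constraint_map A xbar - b) ^+ 2 <=
    \sum_(k < K.+1) w k * norm2 (res k) ^+ 2.
  have := @sqr_norm2_sum_le _ _ K.+1 w (fun k => res k) w_ge0.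
  by rewrite resE w_sum mul1r; apply.
have gap_mean : \sum_(i < n)
    (Fb i - Fs i + dot (adjoint (A i) lams) (xbar i - xs i)) <=
    \sum_(k < K.+1) w k * gap k.
  under [leRHS]eq_bigr do rewrite mulr_sumr.
  rewrite exchange_big; apply: ler_sum => i _.
  have -> : xbar i - xs i = \sum_(k < K.+1) w k *: (x k.+1 i - xs i).
    under [RHS]eq_bigr do rewrite scalerBr.
    by rewrite sumrB -scaler_suml w_sum scale1r.
  rewrite dot_sumr.
  under [leRHS]eq_bigr do rewrite mulrDr mulrBr.
  rewrite big_split sumrB -mulr_suml w_sum mul1r/=.
  rewrite lerD ?lerD2r//.
  by under eq_bigr do rewrite dotZr.
under eq_bigr do rewrite FbE FsE -EFinB -EFinD.
rewrite sumEFin -EFinD lee_fin ler_pdivlMr ?mulr_gt0//.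
have alpha_gt0 : 0 < alpha by exact: alpha_const_gt0.
apply: le_trans sum_le.
apply: (@le_trans _ _ ((\sum_(k < K.+1) w k * gap k + alpha * beta 0 / 2 *
    \sum_(k < K.+1) w k * norm2 (res k) ^+ 2) * (2 * S))).
  rewrite ler_pM2r ?mulr_gt0// lerD// ler_pM2l//.
  by rewrite !mulr_gt0// invr_gt0.
rewrite mulr_sumr -big_split mulr_suml/=; apply: ler_sum => k _.
have wE : w k * S = (beta k)^-1 by rewrite mulfVK// gt_eqF.
have -> : (w k * gap k + alpha * beta 0 / 2 * (w k * norm2 (res k) ^+ 2))
    * (2 * S) =
    2 * (w k * S) * gap k + alpha * (beta 0 * (w k * S)) * norm2 (res k) ^+ 2.
  by field.
(* Only [beta 0 <= beta k] remains. *)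
rewrite wE lerD2l ler_wpM2r ?sqr_ge0// -[leRHS]mulr1 ler_pM2l//.
by rewrite ler_pdivrMr// mul1r; exact: beta_nd.
Qed.
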